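(* Let $\mathcal D$ be a permutation-invariant probability distribution on the payoff set $\mathcal U$. Then for every NE approximator $f$ that is opponent-permutation-invariant (OPI), $$\mathbb E_{u\sim\mathcal D}[\mathcal E((\mathcal Pf)(u),u)]\ \le\ \mathbb E_{u\sim\mathcal D}[\mathcal E(f(u),u)].$$
   Context: Fix a number of players $n\ge2$ and finite action sets $\mathcal A_i=\{1,\dots,m_i\}$, $i\in[n]$; $\mathcal A=\prod_i\mathcal A_i$. A payoff is $u=(u_i)_{i\in[n]}$ with $u_i:\mathcal A\to[0,1]$; $\mathcal U$ is the set of all payoffs. A product strategy is $\sigma=(\sigma_i)_{i\in[n]}$ with $\sigma_i\in\Delta\mathcal A_i$; $u_i(\sigma)=\sum_a\big(\prod_j\sigma_j(a_j)\big)u_i(a)$. The (Nash) equilibrium approximation is $\mathcal E(\sigma,u)=\max_{i\in[n]}\big(\max_{a_i\in\mathcal A_i}u_i(a_i,\sigma_{-i})-u_i(\sigma)\big)$. An NE approximator is a (tacitly measurable) map $f:\mathcal U\to\prod_i\Delta\mathcal A_i$, with $f(u)_i$ player $i$'s strategy (outputs need not be equilibria). Permutations: $\mathcal G_i$ is the group of all bijections $\rho_i:\mathcal A_i\to\mathcal A_i$. $\rho_iu$ is the payoff with $(\rho_iu)_j(a_i,a_{-i})=u_j(\rho_i^{-1}(a_i),a_{-i})$ for all $j$; $(\rho_i\sigma_i)(a_i)=\sigma_i(\rho_i^{-1}(a_i))$. $\mathcal D$ is permutation-invariant if for every $i$ and $\rho_i\in\mathcal G_i$, $u\sim\mathcal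 D$ implies $\rho_iu\sim\mathcal D$. $f$ is OPI if $f(\rho_iu)_j=f(u)_j$ for all $i\in[n]$, $\rho_i\in\mathcal G_i$, $j\ne i$ and $u\in\mathcal U$. Orbit averaging: $(\mathcal P_if)(u)_i=\frac1{|\mathcal A_i|!}\sum_{\rho_i\in\mathcal G_i}\rho_i^{-1}f(\rho_iu)_i$ and $(\mathcal P_if)(u)_j=f(u)_j$ for $j\neq i$; $\mathcal P=\mathcal P_1\circ\cdots\circ\mathcal P_n$. *)

(* Defs.v *)
From HB Require Import structures.
From mathcomp Require Import all_boot all_order all_algebra all_fingroup.
From mathcomp Require Import all_classical all_reals all_analysis.

Set Implicit Arguments.
Unset Strict Implicit.
Unset Printing Implicit Defensive.
Import Order.TTheory GRing.Theory Num.Theory.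
Local Open Scope classical_set_scope.
Local Open Scope ring_scope.

Section FiniteMax.
Context {R : realType} {I : finType}.

(* The supremum is attained because I is finite, so this is a maximum as soon
   as I is nonempty (finmaxP); the value for I empty is never used. *)
Definition finmax (F : I -> R) : R := sup (range F).

Lemma finmaxP (F : I -> R) (i0 : I) :
  exists i, finmax F = F i /\ forall j, F j <= F i.
Proof.
case: (@Order.TotalTheory.arg_maxP _ R I i0 xpredT F isT) => i _ Fmax.
exists i; split; last by move=> j; exact: Fmax.
apply/eqP; rewrite eq_le; apply/andP; split.
  apply: ge_sup; first by exists (F i), i.
  by move=> _ [j _ <-]; exact: Fmax.
apply: ub_le_sup; last by exists i.
by exists (F i) => _ [j _ <-]; exact: Fmax.
Qed.

End FiniteMax.

Section Simplex.
Variables (R : realType) (k : nat).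

Record simplex := Simplex {
  simplex_val :> {ffun 'I_k -> R};
  simplexP : [forall a, 0 <= simplex_val a] && (\sum_a simplex_val a == 1) }.

HB.instance Definition _ := [isSub for simplex_val].
HB.instance Definition _ := [Choice of simplex by <:].

Lemma simplex_ge0 (s : simplex) a : 0 <= s a.
Proof. by have /andP[/forallP/(_ a)] := simplexP s. Qed.

Lemma simplex_sum1 (s : simplex) : \sum_a s a = 1.
Proof. by have /andP[_ /eqP] := simplexP s. Qed.

Lemma pure_subproof (a : 'I_k) (p := [ffun b : 'I_k => (b == a)%:R : R]) :
  [forall b, 0 <= p b] && (\sum_b p b == 1).
Proof.
apply/andP; split; first by apply/forallP => b; rewrite ffunE ler0n.
rewrite (bigD1 a) //= big1 => [|b /negPf ba]; last by rewrite ffunE ba.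
by rewrite ffunE eqxx addr0.
Qed.

Definition pure (a : 'I_k) : simplex := Simplex (pure_subproof a).

Lemma perm_strategy_subproof (rho : {perm 'I_k}) (s : simplex)
    (p := [ffun a => s (rho^-1%g a)]) :
  [forall b, 0 <= p b] && (\sum_b p b == 1).
Proof.
apply/andP; split; first by apply/forallP => b; rewrite ffunE simplex_ge0.
rewrite -(simplex_sum1 s) (reindex_inj (@perm_inj _ rho)) /=.
by apply/eqP/eq_bigr => b _; rewrite ffunE permK.
Qed.

Definition perm_strategy (rho : {perm 'I_k}) (s : simplex) : simplex :=
  Simplex (perm_strategy_subproof rho s).

Lemma perm_average_subproof (s : {perm 'I_k} -> simplex)
    (p := [ffun a => (k`!)%:R^-1 * \sum_(rho : {perm 'I_k}) s rho a]) :
  [forall b, 0 <= p b] && (\sum_b p b == 1).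
Proof.
apply/andP; split.
  apply/forallP => b; rewrite ffunE mulr_ge0 ?invr_ge0 ?ler0n ?sumr_ge0 //.
  by move=> rho _; exact: simplex_ge0.
under eq_bigr do rewrite ffunE.
rewrite -mulr_sumr exchange_big /=.
under eq_bigr do rewrite simplex_sum1.
by rewrite sumr_const card_Sn mulVf // pnatr_eq0 -lt0n fact_gt0.
Qed.

Definition perm_average (s : {perm 'I_k} -> simplex) : simplex :=
  Simplex (perm_average_subproof s).

End Simplex.

Section Games.
Variables (R : realType) (n : nat) (m : 'I_n -> nat).

Definition profile := {dffun forall i : 'I_n, 'I_(m i)}.

Record payoff := Payoff {
  payoff_val :> {ffun 'I_n -> {ffun profile -> R}};
  payoffP : [forall i, forall a, 0 <= payoff_val i a <= 1] }.

HB.instance Definition _ := [isSub for payoff_val].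
HB.instance Definition _ := [Choice of payoff by <:].

Lemma payoff01 (u : payoff) i a : 0 <= u i a <= 1.
Proof. by have /forallP/(_ i)/forallP/(_ a) := payoffP u. Qed.

Lemma payoff0_subproof (u := [ffun _ : 'I_n => [ffun _ : profile => 0 : R]]) :
  [forall i, forall a, 0 <= u i a <= 1].
Proof. by apply/forallP => i; apply/forallP => a; rewrite !ffunE lexx ler01. Qed.

HB.instance Definition _ := isPointed.Build payoff (Payoff payoff0_subproof).

(* The sigma-algebra generated by the coordinates u |-> u i a, i.e. the Borel
   sigma-algebra of the finite-dimensional cube of payoffs. *)
Definition payoff_cylinders : set (set payoff) :=
  \bigcup_(ia in [set: 'I_n * profile])
    preimage_set_system setT (fun u : payoff => u ia.1 ia.2)
      (@measurable _ R).

HB.instance Definition _ := @isMeasurable.Build (sigma_display payoff_cylinders) payoff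
  <<s payoff_cylinders >> (@sigma_algebra0 _ setT payoff_cylinders)
  (@sigma_algebraC _ payoff_cylinders)
  (@sigma_algebra_bigcup _ setT payoff_cylinders).

Definition strategy := forall i : 'I_n, simplex R (m i).

Definition utility (u : payoff) (i : 'I_n) (sigma : strategy) : R :=
  \sum_(a : profile) (\prod_j sigma j (a j)) * u i a.

Definition equilibrium_approx (sigma : strategy) (u : payoff) : R :=
  finmax (fun i : 'I_n =>
    finmax (fun ai : 'I_(m i) => utility u i (dfwith sigma i (pure R ai)))
    - utility u i sigma).

Definition perm_profile (i : 'I_n) (rho : {perm 'I_(m i)}) (a : profile) :
    profile :=
  [ffun j => dfwith a i (rho (a i)) j].

Lemma perm_payoff_subproof (i : 'I_n) (rho : {perm 'I_(m i)}) (u : payoff)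
    (v := [ffun j => [ffun a => u j (perm_profile rho^-1%g a)]]) :
  [forall j, forall a, 0 <= v j a <= 1].
Proof.
by apply/forallP => j; apply/forallP => a; rewrite !ffunE payoff01.
Qed.

Definition perm_payoff (i : 'I_n) (rho : {perm 'I_(m i)}) (u : payoff) :
    payoff :=
  Payoff (perm_payoff_subproof rho u).

Definition permutation_invariant (D : probability payoff R) : Prop :=
  forall (i : 'I_n) (rho : {perm 'I_(m i)}) (A : set payoff),
    measurable A -> pushforward D (perm_payoff rho) A = D A.

Definition approximator := payoff -> strategy.

(* Measurability for the Borel sigma-algebra of the product of simplices,
   expressed coordinatewise. *)
Definition measurable_approximator (f : approximator) : Prop :=
  forall (i : 'I_n) (a : 'I_(m i)),
    measurable_fun [set: payoff] (fun u => f u i a).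

Definition OPI (f : approximator) : Prop :=
  forall (i : 'I_n) (rho : {perm 'I_(m i)}) (j : 'I_n) (u : payoff),
    j != i -> f (perm_payoff rho u) j = f u j.

Definition orbit_average_at (i : 'I_n) (f : approximator) : approximator :=
  fun u => dfwith (f u) i (perm_average (fun rho : {perm 'I_(m i)} =>
    perm_strategy rho^-1%g (f (perm_payoff rho u) i))).

(* P_1 o ... o P_n: the operator of the last player is applied first. *)
Definition orbit_average (f : approximator) : approximator :=
  foldr orbit_average_at f (enum 'I_n).

End Games.

(* Main.v *)
(** For a single player i, opponent-permutation-invariance makes the profile
    (P_i f)(u) the uniform mixture, in coordinate i only, of the profiles
    rho_i^-1 f(rho_i u).  With the opponents fixed, every utility is affine in
    the strategy of player i, so the approximation E(., u), a maximum of affine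
    functions, is convex in it; and E is invariant under relabelling the actions
    of player i in both arguments.  Hence
      E((P_i f)(u), u) <= average over rho_i of E(f(rho_i u), rho_i u),
    and each term of the right-hand side has the same D-expectation as
    E(f(u), u).  Since P_i f is again measurable and
    opponent-permutation-invariant, the players can be treated one after the
    other. *)
Require Import Defs.
From mathcomp Require Import all_boot all_order all_algebra all_fingroup.
From mathcomp Require Import all_classical all_reals all_analysis.
From mathcomp Require Import measurable_realfun.
Local Open Scope ring_scope.
Import Order.TTheory GRing.Theory Num.Theory.

(** * Changing one coordinate of a dependent function *)

Section DependentUpdate.
Context {I : eqType} {T : I -> Type}.
Implicit Types (f : forall i, T i) (i j : I).

Lemma dfwith_id f i : dfwith f i (f i) = f.
Proof. by apply: functional_extensionality_dep => j; case: dfwithP. Qed.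

Lemma dfwith_override f i (x y : T i) :
  dfwith (dfwith f i x) i y = dfwith f i y.
Proof.
apply: functional_extensionality_dep => j; case: dfwithP => [|k ik].
  by rewrite dfwithin.
by rewrite !dfwithout.
Qed.

Lemma dfwith_comm f i j (x : T i) (y : T j) : i != j ->
  dfwith (dfwith f i x) j y = dfwith (dfwith f j y) i x.
Proof.
move=> ij; apply: functional_extensionality_dep => k.
have [<-|ik] := eqVneq i k; first by rewrite dfwithin dfwithout 1?eq_sym// dfwithin.
have [<-|jk] := eqVneq j k; first by rewrite dfwithin dfwithout// dfwithin.
by rewrite !dfwithout.
Qed.

End DependentUpdate.

(** * Finite maxima and their measurability *)

Section FinMax.
Context {R : realType} {I : finType}.
Implicit Types (F : I -> R).

Lemma le_finmax F i : F i <= finmax F.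
Proof. by have [j [-> ]] := finmaxP F i; apply. Qed.

Lemma finmax_le F c (i0 : I) : (forall i, F i <= c) -> finmax F <= c.
Proof. by move=> Fc; have [j [-> _]] := finmaxP F i0. Qed.

(** Replaces a supremum by iterated binary maxima, so that measurability follows by induction on the
    index list. The seed [F i0] is itself one of the values. *)
Lemma finmax_bigmax F (i0 : I) : finmax F = \big[Num.max/F i0]_i F i.
Proof.
apply/eqP; rewrite eq_le; apply/andP; split.
  by apply: (finmax_le _ _ i0) => i; exact: le_bigmax.
by apply: bigmax_le => [|i _]; exact: le_finmax.
Qed.

Lemma measurable_finmax d (T : measurableType d) (F : I -> T -> R) (i0 : I) :
  (forall i, measurable_fun setT (F i)) ->
  measurable_fun setT (fun x => finmax (F ^~ x)).
Proof.
move=> mF; under eq_fun do rewrite (finmax_bigmax _ i0).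
elim: (index_enum I) => [|i s IH].
  by under eq_fun do rewrite big_nil; exact: mF.
under eq_fun do rewrite big_cons.
exact: measurable_maxr.
Qed.

End FinMax.

(** * Utilities, affine in the strategy of one player *)

Section Game.
Context {R : realType} {n : nat} {m : 'I_n -> nat}.
Implicit Types (u : payoff R m) (sigma : strategy R m) (f : approximator R m).
Implicit Types (i j : 'I_n).

(** Isolates the factor of player [i]: the coefficient of [s (a i)] does not involve [s], which
    makes linearity in [s] explicit. *)
Lemma utility_dfwith u j sigma i (s : simplex R (m i)) :
  utility u j (dfwith sigma i s) =
  \sum_(a : profile m) s (a i) * (\prod_(k | k != i) sigma k (a k) * u j a).
Proof.
apply: eq_bigr => a _; rewrite (bigD1 i)//= dfwithin -mulrA; congr (_ * (_ * _)).
by apply: eq_bigr => k ki; rewrite dfwithout// eq_sym.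
Qed.

Lemma utility_perm_average u j sigma i (s : {perm 'I_(m i)} -> simplex R (m i)) :
  utility u j (dfwith sigma i (perm_average s)) =
  ((m i)`!)%:R^-1 * \sum_rho utility u j (dfwith sigma i (s rho)).
Proof.
under eq_bigr do rewrite utility_dfwith.
rewrite utility_dfwith exchange_big mulr_sumr; apply: eq_bigr => a _ /=.
by rewrite ffunE -mulrA mulr_suml.
Qed.

Lemma utility_pure u j sigma i :
  utility u j sigma =
  \sum_b sigma i b * utility u j (dfwith sigma i (pure R b)).
Proof.
under eq_bigr do rewrite utility_dfwith mulr_sumr.
rewrite exchange_big -{1}(dfwith_id sigma i) utility_dfwith.
apply: eq_bigr => a _ /=; rewrite (bigD1 (a i))//=.
rewrite [X in _ + X]big1 => [|b /negPf ba].
  by rewrite addr0 ffunE eqxx mul1r.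
by rewrite ffunE eq_sym ba mul0r mulr0.
Qed.

(** The inner term of [equilibrium_approx sigma u], which is convertible to
    [finmax (regret sigma u)]. *)
Definition regret sigma u j : R :=
  finmax (fun a => utility u j (dfwith sigma j (pure R a))) - utility u j sigma.

(** * Relabelling the actions of one player *)

Lemma perm_profileK i (rho : {perm 'I_(m i)}) :
  cancel (perm_profile rho) (perm_profile rho^-1%g).
Proof.
move=> a; apply/ffunP => k; rewrite ffunE.
have [<-|ik] := eqVneq i k; first by rewrite dfwithin ffunE dfwithin permK.
by rewrite dfwithout// ffunE dfwithout.
Qed.

Lemma perm_payoffK i (rho : {perm 'I_(m i)}) u :
  perm_payoff rho^-1%g (perm_payoff rho u) = u.
Proof.
apply: val_inj; apply/ffunP => j; apply/ffunP => a.
by rewrite /= !ffunE invgK perm_profileK.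
Qed.

Lemma perm_payoff_comm i k (rho : {perm 'I_(m i)}) (tau : {perm 'I_(m k)}) u :
  i != k ->
  perm_payoff rho (perm_payoff tau u) = perm_payoff tau (perm_payoff rho u).
Proof.
move=> ik; apply: val_inj; apply/ffunP => j; apply/ffunP => a.
rewrite /= !ffunE; congr (u j _); apply/ffunP => l; rewrite !ffunE.
rewrite (dfwithout _ _ ik) (@dfwithout _ _ a k _ i) 1?eq_sym//.
have [<-|il] := eqVneq i l.
  by rewrite dfwithin dfwithout 1?eq_sym// ffunE dfwithin.
have [<-|kl] := eqVneq k l.
  by rewrite dfwithin dfwithout// ffunE dfwithin.
by rewrite !dfwithout// !ffunE !dfwithout.
Qed.

Lemma utility_perm i (rho : {perm 'I_(m i)}) u j sigma :
  utility (perm_payoff rho u) j (dfwith sigma i (perm_strategy rho (sigma i))) =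
  utility u j sigma.
Proof.
rewrite -[in RHS](dfwith_id sigma i) !utility_dfwith.
rewrite (reindex_inj (can_inj (perm_profileK i rho))) /=.
apply: eq_bigr => a _; rewrite !ffunE dfwithin permK perm_profileK.
congr (_ * (_ * _)); apply: eq_bigr => k ki.
by rewrite ffunE dfwithout// eq_sym.
Qed.

Lemma perm_strategy_pure k (rho : {perm 'I_k}) (a : 'I_k) :
  perm_strategy rho (pure R a) = pure R (rho a).
Proof.
apply: val_inj; apply/ffunP => b; rewrite /= !ffunE.
by rewrite -(inj_eq (@perm_inj _ rho)) permKV.
Qed.

(** * Invariance and convexity of the approximation *)

Context (m_gt0 : forall i, (0 < m i)%N).

Lemma regret_ge0 sigma u j : 0 <= regret sigma u j.
Proof.
rewrite subr_ge0 (utility_pure _ _ _ j); set M := finmax _.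
rewrite -[leRHS]mul1r -(simplex_sum1 (sigma j)) mulr_suml.
apply: ler_sum => b _; apply: ler_wpM2l; first exact: simplex_ge0.
exact: (le_finmax (fun a => utility u j (dfwith sigma j (pure R a)))).
Qed.

(** Relabelling only permutes the pure deviations: each one on the left has the utility of some
    deviation on the right. *)
Lemma regret_perm i (rho : {perm 'I_(m i)}) u j sigma :
  regret (dfwith sigma i (perm_strategy rho (sigma i))) (perm_payoff rho u) j
  <= regret sigma u j.
Proof.
rewrite /regret utility_perm lerB//.
apply: (finmax_le _ _ (Ordinal (m_gt0 j))) => a.
set F := (X in _ <= finmax X).
suff [b ->] : exists b, utility (perm_payoff rho u) j
    (dfwith (dfwith sigma i (perm_strategy rho (sigma i))) j (pure R a)) = F b.
  exact: le_finmax.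
have [ij|ij] := eqVneq i j.
  (* The deviator is the relabelled player: [a] is the new name of the action [rho^-1 a]. *)
  case: j / ij a @F => a F.
  exists (rho^-1%g a); rewrite /F -[RHS](utility_perm i rho).
  by rewrite dfwithin !dfwith_override perm_strategy_pure permKV.
exists a; rewrite /F -[RHS](utility_perm i rho) dfwith_comm//.
by rewrite (dfwithout sigma _ (i := j) (j := i)) 1?eq_sym.
Qed.

(** A maximum of averages is at most the average of the maxima, while the subtracted utility
    averages exactly. *)
Lemma regret_perm_average u j sigma i (s : {perm 'I_(m i)} -> simplex R (m i)) :
  regret (dfwith sigma i (perm_average s)) u j <=
  ((m i)`!)%:R^-1 * \sum_rho regret (dfwith sigma i (s rho)) u j.
Proof.
rewrite /regret sumrB mulrBr utility_perm_average lerB//.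
apply: (finmax_le _ _ (Ordinal (m_gt0 j))) => a.
have avg_const c :
    ((m i)`!)%:R^-1 * \sum_(rho : {perm 'I_(m i)}) c = c :> R.
  by rewrite sumr_const card_Sn -[c *+ _]mulr_natl mulKf.
have -> : utility u j (dfwith (dfwith sigma i (perm_average s)) j (pure R a)) =
    ((m i)`!)%:R^-1 *
      \sum_rho utility u j (dfwith (dfwith sigma i (s rho)) j (pure R a)).
  (* A deviation of player [i] overwrites the mixture, leaving a constant average; one of another
     player commutes with it. *)
  have [ij|ij] := eqVneq i j.
    case: j / ij a => a; under eq_bigr do rewrite dfwith_override.
    by rewrite avg_const dfwith_override.
  rewrite dfwith_comm// utility_perm_average; congr (_ * _).
  by apply: eq_bigr => rho _; rewrite [in RHS]dfwith_comm.
apply: ler_wpM2l; first by rewrite invr_ge0 ler0n.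
apply: ler_sum => rho _.
exact: (le_finmax (fun b =>
  utility u j (dfwith (dfwith sigma i (s rho)) j (pure R b)))).
Qed.

Lemma equilibrium_approx_ge0 (i0 : 'I_n) sigma u :
  0 <= equilibrium_approx sigma u.
Proof.
exact: le_trans (regret_ge0 sigma u i0) (le_finmax (regret sigma u) i0).
Qed.

Lemma equilibrium_approx_perm i (rho : {perm 'I_(m i)}) u sigma :
  equilibrium_approx (dfwith sigma i (perm_strategy rho (sigma i)))
    (perm_payoff rho u) <= equilibrium_approx sigma u.
Proof.
apply: (finmax_le _ _ i) => j.
exact: le_trans (regret_perm i rho u j sigma) (le_finmax (regret sigma u) j).
Qed.

Lemma equilibrium_approx_perm_average u sigma i
    (s : {perm 'I_(m i)} -> simplex R (m i)) :
  equilibrium_approx (dfwith sigma i (perm_average s)) u <=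
  ((m i)`!)%:R^-1 * \sum_rho equilibrium_approx (dfwith sigma i (s rho)) u.
Proof.
apply: (finmax_le _ _ i) => j; apply: le_trans (regret_perm_average u j _ i s) _.
apply: ler_wpM2l; first by rewrite invr_ge0 ler0n.
apply: ler_sum => rho _.
exact: (le_finmax (regret (dfwith sigma i (s rho)) u)).
Qed.

Lemma equilibrium_approx_orbit_average_at i f u : OPI f ->
  equilibrium_approx (orbit_average_at i f u) u <=
  ((m i)`!)%:R^-1 * \sum_(rho : {perm 'I_(m i)})
    equilibrium_approx (f (perm_payoff rho u)) (perm_payoff rho u).
Proof.
move=> fO; apply: le_trans (equilibrium_approx_perm_average _ _ _ _) _.
apply: ler_wpM2l; first by rewrite invr_ge0 ler0n.
apply: ler_sum => rho _.
(* Writing [u] as [rho^-1 (rho u)] lets the invariance apply to [rho^-1] at the payoff [rho u]; by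
   OPI the opponents play the same at [u] and [rho u]. *)
rewrite -[in leLHS](perm_payoffK i rho u).
have -> : dfwith (f (perm_payoff rho^-1%g (perm_payoff rho u))) i
    (perm_strategy rho^-1%g
      (f (perm_payoff rho (perm_payoff rho^-1%g (perm_payoff rho u))) i)) =
  dfwith (f (perm_payoff rho u)) i
    (perm_strategy rho^-1%g (f (perm_payoff rho u) i)).
  rewrite perm_payoffK; apply: functional_extensionality_dep => k.
  have [<-|ik] := eqVneq i k; first by rewrite !dfwithin.
  by rewrite !dfwithout// fO// eq_sym.
exact: equilibrium_approx_perm.
Qed.

(** In coordinate [i], a relabelling of another player commutes with every [rho] in the average,
    where OPI of [f] then removes it. *)
Lemma OPI_orbit_average_at i f : OPI f -> OPI (orbit_average_at i f).
Proof.
move=> fO k tau j u jk; rewrite /orbit_average_at.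
have [ij|ij] := eqVneq i j; last by rewrite !dfwithout// fO.
case: j / ij jk => ik; rewrite !dfwithin; congr perm_average.
apply: funext => rho; congr perm_strategy.
by rewrite perm_payoff_comm// fO.
Qed.

(** * Measurability *)

Lemma measurable_coordinate j (a : profile m) :
  measurable_fun setT (fun u : payoff R m => u j a).
Proof.
move=> _ B mB; apply: sub_sigma_algebra.
by exists (j, a) => //; exists B.
Qed.

(** Generators suffice, and a coordinate of the relabelled payoff is again a coordinate of [u]. *)
Lemma measurable_perm_payoff i (rho : {perm 'I_(m i)}) :
  measurable_fun setT (@perm_payoff R n m i rho).
Proof.
apply: (@measurability _ _ _ (payoff R m) _ _
  (payoff_cylinders (R := R) (m := m))) => //.
move=> _ [_ [[j a] _ [B mB <-]] <-]; rewrite !setTI.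
have := measurable_coordinate j (perm_profile rho^-1%g a) measurableT _ mB.
rewrite setTI; congr (measurable _); apply: funext => u /=.
by rewrite /preimage/= !ffunE.
Qed.

Lemma measurable_orbit_average_at i f :
  measurable_approximator f -> measurable_approximator (orbit_average_at i f).
Proof.
move=> mf j; rewrite /orbit_average_at.
have [<- a|ij a] := eqVneq i j; last first.
  by under eq_fun do rewrite dfwithout//; exact: mf.
under eq_fun do rewrite dfwithin ffunE.
apply: measurable_funM => //; apply: measurable_sum => rho.
under eq_fun do rewrite ffunE.
exact: (measurableT_comp (mf i _) (measurable_perm_payoff i rho)).
Qed.

Lemma measurable_utility f j : measurable_approximator f ->
  measurable_fun setT (fun u => utility u j (f u)).
Proof.
move=> mf; apply: measurable_sum => a; apply: measurable_funM.
  by apply: measurable_prod => k _; exact: mf.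
exact: measurable_coordinate.
Qed.

Lemma measurable_equilibrium_approx (i0 : 'I_n) f : measurable_approximator f ->
  measurable_fun setT (fun u => equilibrium_approx (f u) u).
Proof.
move=> mf; apply: (measurable_finmax _ _ _ i0) => j.
apply: measurable_funB; last exact: measurable_utility.
apply: (measurable_finmax _ _ _ (Ordinal (m_gt0 j))) => a.
(* Fixing player [j] at a pure action gives another measurable approximator. *)
apply: (measurable_utility (fun u => dfwith (f u) j (pure R a))) => k.
have [<- b|jk b] := eqVneq j k.
  by under eq_fun do rewrite dfwithin; exact: measurable_cst.
by under eq_fun do rewrite dfwithout//; exact: mf.
Qed.

(** * Expectations under an invariant distribution *)

Context {D : probability (payoff R m) R} (D_inv : permutation_invariant D).

Lemma integral_perm_payoff i (rho : {perm 'I_(m i)}) (g : payoff R m -> \bar R) :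
  measurable_fun setT g -> (forall u, 0 <= g u)%E ->
  (\int[D]_u g (perm_payoff rho u) = \int[D]_u g u)%E.
Proof.
move=> mg g0.
have mp := measurable_perm_payoff i rho.
transitivity (\int[pushforward D (perm_payoff rho)]_u g u)%E.
  by rewrite (ge0_integral_pushforward mp).
by apply: eq_measure_integral => A mA _; exact: D_inv.
Qed.

Lemma expectation_orbit_average_at i f :
  measurable_approximator f -> OPI f ->
  ('E_D[fun u => equilibrium_approx (orbit_average_at i f u) u] <=
   'E_D[fun u => equilibrium_approx (f u) u])%E.
Proof.
move=> mf fO; rewrite unlock.
pose g u : \bar R := (equilibrium_approx (f u) u)%:E.
have g0 u : (0 <= g u)%E by rewrite lee_fin equilibrium_approx_ge0.
have mg : measurable_fun setT g.
  by apply/measurable_EFinP; exact: measurable_equilibrium_approx.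
have mgp (rho : {perm 'I_(m i)}) :
    measurable_fun setT (fun u => g (perm_payoff rho u)).
  exact: (measurableT_comp mg (measurable_perm_payoff i rho)).
pose c : R := ((m i)`!)%:R^-1.
have c0 : 0 <= c by rewrite invr_ge0 ler0n.
have msum : measurable_fun setT
    (fun u => \sum_(rho : {perm 'I_(m i)}) g (perm_payoff rho u))%E.
  exact: emeasurable_sum.
apply: (@le_trans _ _
  (\int[D]_u (c%:E * \sum_(rho : {perm 'I_(m i)}) g (perm_payoff rho u)))%E).
  apply: ge0_le_integral => //.
  - by move=> u _; rewrite lee_fin equilibrium_approx_ge0.
  - apply/measurable_EFinP; apply: measurable_equilibrium_approx => //.
    exact: measurable_orbit_average_at.
  - exact: measurable_funeM.
  - move=> u _; rewrite sumEFin -EFinM lee_fin.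
    exact: equilibrium_approx_orbit_average_at.
rewrite ge0_integralZl_EFin//; last by move=> u _; exact: sume_ge0.
rewrite ge0_integral_sum//.
(* All [(m i)!] summands now have the same integral, and their number cancels [c]. *)
under eq_bigr do rewrite integral_perm_payoff//.
by rewrite sumr_const card_Sn -[X in (_ * X)%E]mule_natl muleA -EFinM mulVf ?mul1e.
Qed.

End Game.

Theorem theorem4p8 (R : realType) (n : nat) (m : 'I_n -> nat)
    (n_ge2 : (2 <= n)%N) (m_gt0 : forall i, (0 < m i)%N)
    (D : probability (payoff R m) R) (D_inv : permutation_invariant D)
    (f : approximator R m) (f_meas : measurable_approximator f)
    (f_OPI : OPI f) :
  ('E_D[fun u => equilibrium_approx (orbit_average f u) u] <=
   'E_D[fun u => equilibrium_approx (f u) u])%E.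
Proof.
pose P s := foldr (@orbit_average_at R n m) f s.
(* Induction over an arbitrary list of players; measurability and OPI are carried along because the
   next averaging step requires them. *)
suff H s : [/\ measurable_approximator (P s), OPI (P s) &
    ('E_D[fun u => equilibrium_approx (P s u) u] <=
     'E_D[fun u => equilibrium_approx (f u) u])%E] by have [] := H (enum 'I_n).
elim: s => [|i s [mg gO le_gf]] //=; split.
- exact: measurable_orbit_average_at.
- exact: OPI_orbit_average_at.
- exact: le_trans (expectation_orbit_average_at m_gt0 D_inv i _ mg gO) le_gf.
Qed.
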